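(* Let $G$ be a finite simple graph of maximum degree $\delta_1$, and let $\mathcal{L}(G)$ be its line graph. For every integer $k$ with $2(1-\delta_1)\le k\le 0$, $$a_k(\mathcal{L}(G))\le\delta_1+\left\lceil\frac{k}{2}\right\rceil .$$
   Context: The line graph $\mathcal{L}(G)$ has the edges of $G$ as vertices, two being adjacent when they are distinct edges sharing an endpoint. For a graph $H$ with vertex set $W$, a set $X\subseteq W$ and $w\in W$, $\delta_X(w)$ denotes the number of neighbors of $w$ in $X$, and $\bar S=W\setminus S$. For an integer $k$, a nonempty set $S\subseteq W$ is a defensive $k$-alliance in $H$ if $\delta_S(w)\ge \delta_{\bar S}(w)+k$ for every $w\in S$. The defensive $k$-alliance number $a_k(H)$ is the minimum cardinality of a defensive $k$-alliance in $H$; in particular $a_k(H)=1$ whenever $k\le-\delta$, where $\delta$ is the minimum degree of $H$. (If $\delta_1=0$ the range of $k$ is empty.) *)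

(* Defs.v *)
From mathcomp Require Import all_boot all_order all_algebra.

Set Implicit Arguments.
Unset Strict Implicit.
Unset Printing Implicit Defensive.

Import Order.TTheory GRing.Theory Num.Theory.
Local Open Scope ring_scope.

Record sgraph := SGraph {
  vertex :> finType;
  adj : rel vertex;
  adj_sym : symmetric adj;
  adj_irr : irreflexive adj
}.

Section Graph.

Variable G : sgraph.
Implicit Types (X S : {set G}) (w : G) (k : int).

Definition nbrs_in X w : nat := #|[set u in X | adj w u]|.

Definition degree w : nat := nbrs_in [set: G] w.

(* 0 for the empty graph *)
Definition max_degree : nat := (\max_(w : G) degree w)%N.

Definition edges : {set {set G}} :=
  [set [set p.1; p.2] | p : G * G & adj p.1 p.2].

Definition edge : finType := {e : {set G} | e \in edges}.

Definition edge_adj : rel edge :=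
  fun e f => (e != f) && (val e :&: val f != set0).

Lemma edge_adj_sym : symmetric edge_adj.
Proof. by move=> e f; rewrite /edge_adj eq_sym setIC. Qed.

Lemma edge_adj_irr : irreflexive edge_adj.
Proof. by move=> e; rewrite /edge_adj eqxx. Qed.

Definition line_graph : sgraph := SGraph edge_adj_sym edge_adj_irr.

Definition defensive_alliance k S : bool :=
  (S != set0) &&
  [forall w in S, (nbrs_in (~: S) w)%:Z + k <= (nbrs_in S w)%:Z].

(* The value is #|G|.+1, larger than the cardinality of every subset, when
   there is no defensive k-alliance (which happens for large k); see
   alliance_numberP and alliance_number_none. *)
Definition alliance_number k : nat :=
  \big[minn/#|G|.+1]_(S : {set G} | defensive_alliance k S) #|S|.

Lemma alliance_number_le k S :
  defensive_alliance k S -> (alliance_number k <= #|S|)%N.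
Proof.
move=> kS; rewrite /alliance_number.
have : S \in index_enum {set G} by rewrite mem_index_enum.
elim: (index_enum _) => // T r IH; rewrite in_cons big_cons => /orP[/eqP <-|Sr].
  by rewrite kS geq_minl.
by case: ifP => _; [rewrite geq_min IH // orbT | apply: IH].
Qed.

Lemma alliance_number_none k :
  (forall S, ~~ defensive_alliance k S) -> alliance_number k = #|G|.+1.
Proof. by move=> kN; apply: big_pred0 => S; apply/negbTE/kN. Qed.

Lemma alliance_numberP k S0 : defensive_alliance k S0 ->
  exists2 S, defensive_alliance k S & #|S| = alliance_number k.
Proof.
move=> kS0.
have [[S [kS eS]] | e] : (exists S, defensive_alliance k S /\
    #|S| = alliance_number k) \/ alliance_number k = #|G|.+1.
- rewrite /alliance_number; elim/big_rec: _ => [|S m kS IH]; first by right.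
  rewrite /minn; case: ifP => // _; by left; exists S.
- by exists S.
- by have := alliance_number_le kS0; rewrite e ltnNge max_card.
Qed.

End Graph.

(* Main.v *)
Require Import Defs.
From mathcomp Require Import all_boot all_order all_algebra.
From mathcomp Require Import zify.

(** The edges through a vertex [v] form a clique in the line graph.  Take [v]
of maximum degree [d] and a set [S] of [m] edges through [v].  An edge [uv] of
[S] is adjacent to the other [m - 1] edges of [S].  Its neighbors outside [S]
are among the [d - m] remaining edges through [v] and the at most [d - 1] other
edges through [u], so there are at most [2 d - m - 1] of them
([nbrs_out_star_le]).  Hence [S] is a defensive [k]-alliance as soon as
[2 d + k <= 2 m] ([star_part_alliance]), and [m = d + ceil (k / 2)] is the least
integer with this property.  The two bounds on [k] say that this [m] is
positive, so that [S] is nonempty, and at most [d], so that [v] has enough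
edges. *)

Set Implicit Arguments.
Unset Strict Implicit.
Unset Printing Implicit Defensive.

Import Order.TTheory GRing.Theory Num.Theory.
Local Open Scope ring_scope.

Lemma exists_subset_card (T : finType) (A : {set T}) (m : nat) :
  (m <= #|A|)%N -> exists2 S : {set T}, S \subset A & #|S| = m.
Proof.
move=> mA; exists [set x in take m (enum A)].
  by apply/subsetP => x; rewrite inE => /mem_take; rewrite mem_enum.
rewrite cardsE; have /card_uniqP -> : uniq (take m (enum A)).
  by rewrite take_uniq ?enum_uniq.
by rewrite size_takel // -cardE.
Qed.

Section Star.

Variable G : sgraph.
Implicit Types (u v : G) (e f : edge G) (S : {set edge G}).

Definition star v : {set edge G} := [set e : edge G | v \in val e].

Lemma edgeP (e : edge G) v : v \in val e ->
  exists2 u, adj v u & val e = [set v; u].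
Proof.
case: e => e /= /imsetP[[x y]]; rewrite inE /= => xy -> /set2P[] ->.
  by exists y.
by exists x; rewrite 1?adj_sym 1?setUC.
Qed.

(** Both sides count the two-element sets [[set v; u]] with [u] adjacent
to [v]. *)
Lemma card_star v : #|star v| = degree v.
Proof.
have inj : {in [set u in [set: G] | adj v u] &, injective (fun u => [set v; u])}.
  move=> u w; rewrite !inE /= => vu _ /setP/(_ u); rewrite !inE eqxx orbT.
  by case: eqP vu => [->|_ _ /esym/eqP //]; rewrite adj_irr.
rewrite /degree /nbrs_in -(card_in_imset inj) -(card_imset _ val_inj).
congr #|pred_of_set _|; apply/setP => E; apply/imsetP/imsetP.
  move=> [e]; rewrite inE => /edgeP[u vu eE] ->.
  by exists u; rewrite // !inE.
move=> [u]; rewrite !inE /= => vu ->.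
have uvE : [set v; u] \in edges G by apply/imsetP; exists (v, u); rewrite ?inE.
exists (Sub [set v; u] uvE); last by rewrite SubK.
by rewrite inE SubK !inE eqxx.
Qed.

Lemma degree_le_max v : (degree v <= max_degree G)%N.
Proof. exact: (@leq_bigmax _ (@degree G) v). Qed.

(** Any two edges through [v] share [v], so [e] is adjacent to all of [S] but
itself. *)
Lemma nbrs_in_star v S e : S \subset star v -> e \in S ->
  nbrs_in (G := line_graph G) S e = #|S|.-1.
Proof.
move=> /subsetP Sv eS; rewrite (cardsD1 e S) eS /nbrs_in /=.
congr #|pred_of_set _|; apply/setP => f; rewrite !inE /= /edge_adj eq_sym andbC.
have [fS|_] := boolP (f \in S); last by rewrite !andbF.
have -> : val e :&: val f != set0; last by rewrite !andbT.
have := Sv _ eS; have := Sv _ fS; rewrite !inE => vf ve.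
by apply/set0Pn; exists v; rewrite inE ve vf.
Qed.

(** A neighbor of [uv] outside [S] passes through [v] or through [u]; in the
second case it differs from [uv], which saves one. *)
Lemma nbrs_out_star_le v S e : S \subset star v -> e \in S ->
  (nbrs_in (G := line_graph G) (~: S) e
     <= (degree v - #|S|) + (max_degree G).-1)%N.
Proof.
move=> Sv eS; have := subsetP Sv _ eS; rewrite inE => ve.
have [u vu eE] := edgeP ve.
have eu : e \in star u by rewrite inE eE !inE eqxx orbT.
have sub : [set f in ~: S | edge_adj e f] \subset
    (star v :\: S) :|: (star u :\ e).
  apply/subsetP => f; rewrite !inE => /andP[-> /andP[ef /set0Pn[x]]].
  by rewrite eq_sym ef eE !inE => /andP[/orP[]/eqP-> ->]; rewrite ?orbT.
apply: leq_trans (subset_leq_card sub) _.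
apply: leq_trans (leq_card_setU _ _) _; apply: leq_add.
  by rewrite cardsD (setIidPr Sv) card_star.
have := degree_le_max u; rewrite -card_star (cardsD1 e (star u)) eu /=.
by case: (max_degree G).
Qed.

Lemma star_part_alliance v (k : int) S :
    S \subset star v -> S != set0 ->
    2 * (max_degree G)%:Z + k <= 2 * (#|S|)%:Z ->
  defensive_alliance (G := line_graph G) k S.
Proof.
move=> Sv S0 hk; apply/andP; split=> //; apply/forall_inP => e eS.
have := nbrs_out_star_le Sv eS; rewrite (nbrs_in_star Sv eS).
have := degree_le_max v; have := subset_leq_card Sv; rewrite card_star.
have : (0 < #|S|)%N by rewrite card_gt0.
(* The two occurrences of the outer neighbor count agree only up to unfolding
   the vertex type of the line graph; naming it makes them one atom. *)
by set out := nbrs_in _ e; lia.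
Qed.

End Star.

Lemma max_degree_attained (G : sgraph) :
  (0 < max_degree G)%N -> exists v : G, degree v = max_degree G.
Proof.
move=> d_gt0; have [|v vd] := @bigop.eq_bigmax G (@degree G); last by exists v.
rewrite lt0n; apply: contraTneq d_gt0 => /card0_eq G0.
by rewrite /max_degree big_pred0.
Qed.

Theorem theorem9 (G : sgraph) (k : int)
    (hk_lower : 2 * (1 - (max_degree G)%:Z) <= k) (hk_upper : k <= 0) :
  (alliance_number (line_graph G) k)%:Z
    <= (max_degree G)%:Z + Num.ceil (k%:~R / 2 : rat).
Proof.
set c := Num.ceil _.
have kc : k <= 2 * c.
  have : (k%:~R / 2 : rat) <= c%:~R by exact: ceil_ge.
  by rewrite ler_pdivrMr // -[2]/(2%:~R) -intrM ler_int mulrC.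
have c_le0 : c <= 0.
  by rewrite /c ceil_le_int ler_pdivrMr // mul0r lerz0.
have [v vd] : exists v : G, degree v = max_degree G.
  by apply: max_degree_attained; lia.
have [m mE] : exists m : nat, m%:Z = (max_degree G)%:Z + c.
  by exists (absz ((max_degree G)%:Z + c)); lia.
have [|S Sv Sm] := @exists_subset_card _ (star v) m.
  by rewrite card_star vd; lia.
rewrite -mE lez_nat -Sm; apply: alliance_number_le.
apply: (star_part_alliance Sv); last by rewrite Sm; lia.
by rewrite -card_gt0 Sm; lia.
Qed.
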